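(* Let $S=\begin{bmatrix} S_{11} & S_{12}\\ S_{21} & S_{22}\end{bmatrix}$ be a real $2n\times 2n$ skew-Hamiltonian matrix with $n\times n$ blocks $S_{ij}$. Put $S^{(0)}=S$ and, for $i=1,\ldots,n-1$, let $S^{(i)}=U_i^{-1}S^{(i-1)}U_i$, where the $U_i$ are constructed from $S^{(i-1)}$ as described in the context, either all by construction (A) or all by construction (B). Assume that at every step $i=1,\ldots,n-1$ the condition $$\sum_{j=i+1}^{n} t_{ji}\,r_{ji}\neq 0$$ holds, where $r_{jk}$ and $t_{jk}$ denote the entries of the $(1,1)$ block and of the $(2,1)$ block of $S^{(i-1)}$, respectively, and, for construction (B), that also $\beta$ is finite (i.e. $s^2+r_{i+1,i}s\ne0$) at every step. Then the resulting matrix $S'=S^{(n-1)}$ has zero lower left $n\times n$ block and its upper left $n\times n$ block is of upper Hessenberg form. Moreover, writing the final transformation $U=U_1U_2\cdots U_{n-1}$ as $$U=\begin{bmatrix} L & 0\\ YL & L^{-\mathrm T}\end{bmatrix}\ \text{(construction (A))}\qquad\text{or}\qquad U=\begin{bmatrix} Q & 0\\ YQ & Q\end{bmatrix}\ \text{(construction (B))},$$ the matrix $Y$ is a symmetric solution of the antisymmetric Riccati matrix equation $$-Y S_{12} Y + S_{22} Y - Y S_{11} + S_{21} = 0$$ whose first row and first column are zero.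
   Context: All matrices are real; $L^{-\mathrm T}=(L^{-1})^{\mathrm T}$. With $J=\begin{bmatrix}0&I_n\\-I_n&0\end{bmatrix}$, a $2n\times 2n$ matrix $S$ is skew-Hamiltonian if $J^{\mathrm T}SJ=S^{\mathrm T}$. The $i$-th column of an $n\times n$ matrix $(a_{jk})$ is called Hessenberg if $a_{ji}=0$ for $j>i+1$; a matrix is upper Hessenberg if all its columns are. Step $i$ ($1\le i\le n-1$). Write $r_{jk}$ for the entries of the $(1,1)$ block and $t_{jk}$ for the entries of the $(2,1)$ block of $S^{(i-1)}$, and suppose $\sum_{j=i+1}^n t_{ji}r_{ji}\ne 0$. In both constructions $Y_i=\alpha\, v v^{\mathrm T}$, with $v=(0,\ldots,0,t_{i+1,i},\ldots,t_{n,i})^{\mathrm T}$ (first $i$ entries zero) and $\alpha=1/\sum_{j=i+1}^n t_{ji}r_{ji}$. Construction (A): $U_i=\begin{bmatrix} L_i & 0\\ Y_iL_i & L_i^{-\mathrm T}\end{bmatrix}$. If the $i$-th column of the $(1,1)$ block is already Hessenberg, $L_i=I_n$. Otherwise choose $k\in\{i+1,\ldots,n\}$ with $|r_{ki}|$ maximal among $|r_{i+1,i}|,\ldots,|r_{n,i}|$, let $P$ be the permutation matrix interchanging the indices $k$ and $i+1$ ($P=I_n$ if $k=i+1$), let $(\tilde r_{1},\ldots,\tilde r_{n})^{\mathrm T}=P\,(r_{1i},\ldots,r_{ni})^{\mathrm T}$, and put $L_i=P L'$, where $L'$ is the identity matrix except that its $(j,i+1)$ entry is $w_j=\tilde r_{j}/\tilde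 r_{i+1}$ for $j=i+2,\ldots,n$. Construction (B): $U_i=\begin{bmatrix} Q_i & 0\\ Y_iQ_i & Q_i\end{bmatrix}$ with $Q_i=I_n-2ww^{\mathrm T}$, where $w=(0,\ldots,0,w_{i+1},\ldots,w_n)^{\mathrm T}$ (first $i$ entries zero), $w_{i+1}=\beta\,(r_{i+1,i}+s)$, $w_j=\beta\, r_{ji}$ for $j=i+2,\ldots,n$, $s=\left[r_{i+1,i}^2+\cdots+r_{n,i}^2\right]^{1/2}$ and $\beta=\left[2\,(s^2+r_{i+1,i}\,s)\right]^{-1/2}$. *)

(* Defs.v *)
From mathcomp Require Import all_boot all_order all_algebra.

Set Implicit Arguments.
Unset Strict Implicit.
Unset Printing Implicit Defensive.

Import Order.TTheory GRing.Theory Num.Theory.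
Local Open Scope ring_scope.

(* Indices are 0-based: the step acting on the column i : 'I_n requires
   i.+1 < n.  Under this condition the cyclic successor ordS i is the index
   i + 1; the value of these definitions at i = n - 1 is never used. *)

Definition sympJ (R : rcfType) (n : nat) : 'M[R]_(n + n) :=
  block_mx 0 1%:M (- 1%:M) 0.

Definition skew_hamiltonian (R : rcfType) (n : nat) (S : 'M[R]_(n + n)) : Prop :=
  (sympJ R n)^T *m S *m sympJ R n = S^T.

Definition hessenberg_col (R : rcfType) (n : nat) (A : 'M[R]_n) (i : 'I_n) : Prop :=
  forall j : 'I_n, (i.+1 < j)%N -> A j i = 0.

Definition upper_hessenberg (R : rcfType) (n : nat) (A : 'M[R]_n) : Prop :=
  forall i : 'I_n, hessenberg_col A i.

Definition step_sum (R : rcfType) (n : nat) (i : 'I_n) (S : 'M[R]_(n + n)) : R :=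
  \sum_(j < n | (i < j)%N) dlsubmx S j i * ulsubmx S j i.

Definition step_v (R : rcfType) (n : nat) (i : 'I_n) (S : 'M[R]_(n + n)) : 'cV[R]_n :=
  \col_j (if (i < j)%N then dlsubmx S j i else 0).

Definition step_Y (R : rcfType) (n : nat) (i : 'I_n) (S : 'M[R]_(n + n)) : 'M[R]_n :=
  (step_sum i S)^-1 *: (step_v i S *m (step_v i S)^T).

Definition gauss_mx (R : rcfType) (n : nat) (i : 'I_n) (r : 'cV[R]_n) : 'M[R]_n :=
  \matrix_(j, l) (if (l == ordS i) && (i.+1 < j)%N
                  then r j 0 / r (ordS i) 0 else (j == l)%:R).

(* A relation and not a function, because the index k of maximal modulus
   need not be unique. *)
Definition elimination_mx (R : rcfType) (n : nat) (i : 'I_n) (A L : 'M[R]_n) : Prop :=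
  (hessenberg_col A i /\ L = 1%:M) \/
  (~ hessenberg_col A i /\
   exists k : 'I_n,
     [/\ (i < k)%N,
         forall j : 'I_n, (i < j)%N -> `|A j i| <= `|A k i|
       & L = tperm_mx k (ordS i) *m
               gauss_mx i (tperm_mx k (ordS i) *m col i A)]).

Definition constructionA (R : rcfType) (n : nat) (i : 'I_n)
    (S U : 'M[R]_(n + n)) : Prop :=
  exists L : 'M[R]_n,
    elimination_mx i (ulsubmx S) L /\
    U = block_mx L 0 (step_Y i S *m L) (invmx L)^T.

Definition hh_s (R : rcfType) (n : nat) (i : 'I_n) (A : 'M[R]_n) : R :=
  Num.sqrt (\sum_(j < n | (i < j)%N) A j i ^+ 2).

(* The quantity beta^-2 / 2, so that beta is finite iff it is nonzero. *)
Definition hh_denom (R : rcfType) (n : nat) (i : 'I_n) (A : 'M[R]_n) : R :=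
  hh_s i A ^+ 2 + A (ordS i) i * hh_s i A.

Definition hh_beta (R : rcfType) (n : nat) (i : 'I_n) (A : 'M[R]_n) : R :=
  (Num.sqrt (2 * hh_denom i A))^-1.

Definition hh_w (R : rcfType) (n : nat) (i : 'I_n) (A : 'M[R]_n) : 'cV[R]_n :=
  \col_j (if (j <= i)%N then 0
          else if j == ordS i then hh_beta i A * (A j i + hh_s i A)
          else hh_beta i A * A j i).

Definition householder_mx (R : rcfType) (n : nat) (i : 'I_n) (A : 'M[R]_n) : 'M[R]_n :=
  1%:M - 2 *: (hh_w i A *m (hh_w i A)^T).

Definition constructionB (R : rcfType) (n : nat) (i : 'I_n)
    (S U : 'M[R]_(n + n)) : Prop :=
  let Q := householder_mx i (ulsubmx S) in
  U = block_mx Q 0 (step_Y i S *m Q) Q.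

Definition antisymmetric_riccati (R : rcfType) (n : nat)
    (S : 'M[R]_(n + n)) (Y : 'M[R]_n) : Prop :=
  - (Y *m ursubmx S *m Y) + drsubmx S *m Y - Y *m ulsubmx S + dlsubmx S = 0.

Definition first_row_col_zero (R : rcfType) (n : nat) (Y : 'M[R]_n) : Prop :=
  forall j k : 'I_n, (j == 0 :> nat) || (k == 0 :> nat) -> Y j k = 0.

(* Main.v *)
Require Import Defs.
From mathcomp Require Import all_boot all_order all_algebra.
From mathcomp Require Import perm ring.

Set Implicit Arguments.
Unset Strict Implicit.
Unset Printing Implicit Defensive.

Import Order.TTheory GRing.Theory Num.Theory.
Local Open Scope ring_scope.

(** Every transformation matrix factors as
<<
  [ L    0    ]   [ I 0 ] [ L   0   ]
  [ Y L  L^-T ] = [ Y I ] [ 0  L^-T ]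
>>
with [Y] symmetric: a shear followed by a congruence.  These matrices form a
group and preserve the skew-Hamiltonian block pattern, and similarity by one of
them replaces the lower left block [C] of [S] = [A, B; C, D] by
[L^T (- Y B Y + D Y - Y A + C) L] ([shear_similarity]).  Since [L] is
invertible, annihilating the lower left block is the same as solving the
Riccati equation, so the Riccati claim needs only that the whole product
[U] has this shape and brings the lower left block to zero.

Why one step makes progress.  Suppose that the columns of [C] before [i] vanish
and that the columns of [A] before [i] are Hessenberg.  As [C] is
antisymmetric, its rows before [i] and its entry [(i, i)] also vanish, so column
[i] of [C] is exactly the vector [v] out of which [Y = alpha v v^T] is built.
The normalisation of [alpha] says [Y (A e_i) = v], while [Y e_i = 0]; hence
column [i] of [- Y B Y + A^T Y - Y A + C] is [0 - v + v = 0].  An earlier column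
[k] stays zero because [A e_k] is supported on the indices up to [k+1 <= i],
where [v] vanishes.  On the upper left block the shear changes nothing in
columns up to [i], since [Y] kills the basis vectors up to [e_i], and the
congruence by [L] preserves the columns already treated and makes column [i] Hessenberg
as soon as [L] fixes the vectors supported on the indices up to [i] and
[L^-1 A e_i] is supported on the indices up to [i+1].  This is
[elimination_step_reduced].

Besides invertibility, these two requirements on [L] are all that is used of
the constructions: they are established for pivoted Gaussian elimination in
[elimination_mxP] and for Householder reflections in [householder_mxP].  In the
latter case
[Q = Q^-T], so the generic shape specialises to the one with two equal
diagonal blocks.

After the last step only the last column of [C] might be nonzero, and
antisymmetry makes it vanish too.  Finally every [L] fixes [e_0] and every step
matrix [Y] kills it, and both facts survive the composition law
[Y1 + L1^-T Y2 L1^-1] of shears; by symmetry the first row vanishes as well. *)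

(** * Symplectic shears *)

Lemma invmx_mul (R : comUnitRingType) n (A B : 'M[R]_n) :
  A \in unitmx -> B \in unitmx -> invmx (A *m B) = invmx B *m invmx A.
Proof.
move=> Au Bu; have ABu : A *m B \in unitmx by rewrite unitmx_mul Au.
by apply: (can_inj (mulmxK ABu)); rewrite mulVmx // -mulmxA mulKmx // mulVmx.
Qed.

Section ShearSimilarity.

Variables (R : comUnitRingType) (n : nat).
Implicit Types (A B C D L Y : 'M[R]_n) (S : 'M[R]_(n + n)).

Definition shear_mx L Y : 'M[R]_(n + n) :=
  block_mx L 0 (Y *m L) (invmx L)^T.

(** The composition law: conjugating the second shear past the first
    congruence turns [Y2] into [L1^-T Y2 L1^-1]. *)
Lemma shear_mx_mul L1 Y1 L2 Y2 : L1 \in unitmx -> L2 \in unitmx ->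
  shear_mx L1 Y1 *m shear_mx L2 Y2 =
    shear_mx (L1 *m L2) (Y1 + (invmx L1)^T *m Y2 *m invmx L1).
Proof.
move=> L1u L2u; rewrite /shear_mx mulmx_block !mul0mx !mulmx0 !addr0 add0r.
congr block_mx.
  rewrite mulmxDl !mulmxA; congr (_ + _).
  by rewrite -(mulmxA _ (invmx L1) L1) mulVmx // mulmx1.
by rewrite -trmx_mul invmx_mul.
Qed.

Lemma mul_inv_shear_mx L Y : L \in unitmx ->
  block_mx (invmx L) 0 (- (L^T *m Y)) L^T *m shear_mx L Y = 1%:M.
Proof.
move=> Lu; rewrite /shear_mx mulmx_block !mul0mx !mulmx0 !addr0 add0r mulVmx //.
rewrite mulNmx mulmxA addNr -trmx_mul mulVmx // trmx1.
by rewrite -scalar_mx_block.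
Qed.

Lemma shear_mx_unit L Y : L \in unitmx -> shear_mx L Y \in unitmx.
Proof. by move=> /(mul_inv_shear_mx Y)/mulmx1_unit[]. Qed.

Lemma invmx_shear L Y : L \in unitmx ->
  invmx (shear_mx L Y) = block_mx (invmx L) 0 (- (L^T *m Y)) L^T.
Proof.
move=> Lu; apply: (can_inj (mulmxK (shear_mx_unit Y Lu))).
by rewrite mulVmx ?shear_mx_unit // mul_inv_shear_mx.
Qed.

(** The lower left block is congruent to the left-hand side of the Riccati
    equation, which is what ties block triangularisation to that equation. *)
Lemma shear_similarity A B C D L Y : L \in unitmx ->
  invmx (shear_mx L Y) *m block_mx A B C D *m shear_mx L Y =
    block_mx (invmx L *m (A + B *m Y) *m L) (invmx L *m B *m (invmx L)^T)
      (L^T *m (- (Y *m B *m Y) + D *m Y - Y *m A + C) *m L)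
      (L^T *m (D - Y *m B) *m (invmx L)^T).
Proof.
move=> Lu; rewrite invmx_shear // /shear_mx !mulmx_block.
rewrite !mul0mx !mulmx0 !addr0 !add0r.
congr block_mx.
- by rewrite mulmxDr mulmxDl !mulmxA.
- rewrite !mulmxDr !mulmxDl !(mulNmx, mulmxN) !mulmxA.
  by rewrite addrC !addrA.
- by rewrite !mulmxDr !mulmxDl !(mulNmx, mulmxN) !mulmxA addrC.
Qed.

End ShearSimilarity.

(** * Vectors supported on leading indices *)

Section Support.

Variables (R : comUnitRingType) (n : nat).
Implicit Types (L : 'M[R]_n) (x : 'cV[R]_n).

Definition vanish_below m x := forall j : 'I_n, (m < j)%N -> x j 0 = 0.

(** Being the identity on the span of the basis vectors up to [m]: the property
    of the factors [L] that protects the columns already reduced. *)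
Definition fixes_top m L := forall x, vanish_below m x -> L *m x = x.

Lemma vanish_belowW m p x : (m <= p)%N -> vanish_below m x -> vanish_below p x.
Proof. by move=> le_mp x0 j lt_pj; apply: x0; apply: leq_ltn_trans lt_pj. Qed.

Lemma fixes_topW m p L : (m <= p)%N -> fixes_top p L -> fixes_top m L.
Proof. by move=> le_mp Lfix x /(vanish_belowW le_mp)/Lfix. Qed.

Lemma vanish_below_delta (k : 'I_n) : vanish_below k (delta_mx k 0).
Proof. by move=> j lt_kj; rewrite mxE -val_eqE gtn_eqF. Qed.

Lemma fixes_top1 m : fixes_top m 1%:M.
Proof. by move=> x _; rewrite mul1mx. Qed.

Lemma fixes_topM m L1 L2 :
  fixes_top m L1 -> fixes_top m L2 -> fixes_top m (L1 *m L2).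
Proof. by move=> f1 f2 x x0; rewrite -mulmxA f2 // f1. Qed.

Lemma fixes_topV m L : L \in unitmx -> fixes_top m L -> fixes_top m (invmx L).
Proof. by move=> Lu Lfix x /Lfix Lx; rewrite -{1}Lx mulKmx. Qed.

Lemma col_mul_fixes_top m (A L : 'M[R]_n) (k : 'I_n) :
  (k <= m)%N -> fixes_top m L -> col k (A *m L) = col k A.
Proof.
move=> le_km Lfix; rewrite !colE -mulmxA Lfix //.
exact/(vanish_belowW le_km)/vanish_below_delta.
Qed.

(** Gauss transformations, transpositions and reflections are all most easily
    inverted through their action on vectors. *)
Lemma unit_of_vec_inverse L M :
  (forall x : 'cV[R]_n, M *m (L *m x) = x) -> L \in unitmx /\ invmx L = M.
Proof.
move=> MLx; have ML1 : M *m L = 1%:M.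
  apply/matrixP => j k; have /colP/(_ j) := MLx (delta_mx k 0).
  by rewrite mulmxA -colE !mxE andbT.
have [_ Lu] := mulmx1_unit ML1; split=> //.
by apply: (can_inj (mulmxK Lu)); rewrite mulVmx.
Qed.

End Support.

(** * Elimination by Gauss transformations *)

Lemma ordS_val n (i : 'I_n) : (i.+1 < n)%N -> ordS i = i.+1 :> nat.
Proof. by move=> lt_in /=; rewrite modn_small. Qed.

Lemma gtn_ordSF n (i j : 'I_n) :
  (i.+1 < n)%N -> (i.+1 < j)%N -> (j == ordS i) = false.
Proof.
move=> lt_in lt_ij; rewrite -val_eqE -(ordS_val lt_in) in lt_ij *.
by rewrite gtn_eqF.
Qed.

Lemma mul_outer (R : comNzRingType) n (x y z : 'cV[R]_n) :
  x *m y^T *m z = (\sum_j y j 0 * z j 0) *: x.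
Proof.
rewrite -mulmxA [y^T *m z]mx11_scalar mul_mx_scalar; congr (_ *: _).
by rewrite !mxE; apply: eq_bigr => j _; rewrite !mxE.
Qed.

Section Gauss.

Variables (R : rcfType) (n : nat) (i : 'I_n).
Hypothesis lt_in : (i.+1 < n)%N.
Implicit Types (A L : 'M[R]_n) (r x : 'cV[R]_n).

Definition gauss_tail r : 'cV[R]_n :=
  \col_j (if (i.+1 < j)%N then r j 0 / r (ordS i) 0 else 0).

(** A Gauss transformation is the rank-one perturbation [I + g e_{i+1}^T] of the
    identity, where [g] is the tail of multipliers. *)
Lemma gauss_mxE r x :
  gauss_mx i r *m x = x + x (ordS i) 0 *: gauss_tail r.
Proof.
apply/colP => j; rewrite !mxE.
case: ifP => lt_ij; last first.
  rewrite mulr0 addr0 (bigD1 j) //= !mxE lt_ij andbF eqxx mul1r.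
  rewrite big1 ?addr0 // => l.
  by rewrite eq_sym => /negPf ne_jl; rewrite mxE lt_ij andbF ne_jl mul0r.
rewrite (bigD1 j) //= (bigD1 (ordS i)) /=; last by rewrite eq_sym gtn_ordSF.
rewrite !mxE gtn_ordSF // eqxx /= eqxx lt_ij mul1r big1 ?addr0.
  by rewrite [_ * x _ _]mulrC.
move=> l /andP[ne_lj /negPf ne_l]; rewrite mxE ne_l /= eq_sym.
by rewrite (negPf ne_lj) mul0r.
Qed.

Lemma gauss_tail_pivot r : gauss_tail r (ordS i) 0 = 0.
Proof. by rewrite mxE ordS_val // ltnn. Qed.

(** Since [g] vanishes at the pivot index, [(g e_{i+1}^T)^2 = 0] and the inverse
    is obtained by changing the sign of the perturbation. *)
Lemma gauss_mx_unit r : gauss_mx i r \in unitmx /\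
  invmx (gauss_mx i r) = 1%:M - gauss_tail r *m (delta_mx (ordS i) 0)^T.
Proof.
apply: unit_of_vec_inverse => x.
rewrite gauss_mxE mulmxBl mul1mx mul_outer.
rewrite (bigD1 (ordS i)) //= big1 => [|j /negPf nej]; last first.
  by rewrite !mxE nej mul0r.
rewrite addr0 [delta_mx _ _ _ _]mxE !eqxx mul1r.
suff -> : (x + x (ordS i) 0 *: gauss_tail r) (ordS i) 0 = x (ordS i) 0.
  by rewrite addrK.
by rewrite mxE [X in _ + X]mxE gauss_tail_pivot mulr0 addr0.
Qed.

Lemma fixes_top_gauss r : fixes_top i (gauss_mx i r).
Proof. by move=> x x0; rewrite gauss_mxE x0 ?ordS_val // scale0r addr0. Qed.

Lemma gauss_mx_eliminates r : r (ordS i) 0 != 0 ->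
  vanish_below i.+1 (invmx (gauss_mx i r) *m r).
Proof.
move=> r_neq0 j lt_ij; have [_ ->] := gauss_mx_unit r.
rewrite mulmxBl mul1mx mul_outer (bigD1 (ordS i)) //= big1 => [|l /negPf nel].
  by rewrite addr0 !mxE !eqxx mul1r lt_ij mulrC divfK // subrr.
by rewrite !mxE nel mul0r.
Qed.

Lemma tperm_mx_colE (k l : 'I_n) x :
  tperm_mx k l *m x = \col_j x (tperm k l j) 0.
Proof. by rewrite -xrowE; apply/colP=> j; rewrite !mxE. Qed.

(** When the column is not yet Hessenberg, some entry below the subdiagonal is
    nonzero, so the entry of maximal modulus that the pivoting brings to the
    subdiagonal position is nonzero and the multipliers do eliminate the
    entries below it.  The interchange only involves indices beyond [i]. *)
Lemma elimination_mxP A L : elimination_mx i A L ->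
  [/\ L \in unitmx, fixes_top i L & vanish_below i.+1 (invmx L *m col i A)].
Proof.
case=> [[hessA ->] | [not_hess [k [lt_ik r_max ->]]]].
  split; [exact: unitmx1 | exact: fixes_top1 |].
  by move=> j /hessA Aj; rewrite invmx1 mul1mx mxE.
set P := tperm_mx _ _; set r := P *m col i A.
have PP x : P *m (P *m x) = x.
  by rewrite !tperm_mx_colE; apply/colP => j; rewrite !mxE tpermK.
have [Pu PV] : P \in unitmx /\ invmx P = P by apply: unit_of_vec_inverse.
have [Gu _] := gauss_mx_unit r.
have Pfix : fixes_top i P.
  move=> x x0; rewrite tperm_mx_colE; apply/colP => j; rewrite mxE.
  by case: tpermP => // ->; rewrite !x0 ?ordS_val.
(* A zero pivot would bound all entries of the column below [i] by zero. *)
have r_neq0 : r (ordS i) 0 != 0.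
  rewrite /r tperm_mx_colE !mxE tpermR; apply/eqP => Aki.
  apply: not_hess => j lt_ij; apply/eqP; rewrite -normr_le0 -(normr0 R) -Aki.
  exact/r_max/ltnW.
split; first by rewrite unitmx_mul Pu.
  exact/fixes_topM/fixes_top_gauss.
rewrite invmx_mul // PV -mulmxA.
exact: gauss_mx_eliminates.
Qed.

End Gauss.

(** * Elimination by Householder reflections *)

Section Householder.

Variables (R : rcfType) (n : nat) (i : 'I_n) (A : 'M[R]_n).
Hypotheses (lt_in : (i.+1 < n)%N) (d_neq0 : hh_denom i A != 0).

(** The reflection vector before normalisation, [w = beta u]. *)
Let u : 'cV[R]_n :=
  \col_j (if (j <= i)%N then 0 else A j i + (j == ordS i)%:R * hh_s i A).

Lemma hh_wE : hh_w i A = hh_beta i A *: u.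
Proof.
apply/colP => j; rewrite !mxE; case: ifP => _; first by rewrite mulr0.
by case: ifP => _; rewrite ?mul1r ?mul0r ?addr0.
Qed.

(** The vector [u] is the part of the column below the index [i], plus
    [s e_{i+1}]; this computes all the inner products with [u] below. *)
Lemma hh_sumE (F : 'I_n -> R) : \sum_j u j 0 * F j =
  \sum_(j < n | (i < j)%N) A j i * F j + hh_s i A * F (ordS i).
Proof.
transitivity (\sum_(j < n | (i < j)%N) A j i * F j +
    \sum_(j < n | (i < j)%N) (j == ordS i)%:R * hh_s i A * F j).
  rewrite -big_split [RHS]big_mkcond; apply: eq_bigr => j _ /=.
  by rewrite mxE; case: ltnP => _; rewrite ?mul0r // mulrDl.
congr (_ + _); rewrite (bigD1 (ordS i)) ?ordS_val //= eqxx mul1r big1 ?addr0 //.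
by move=> j /andP[_ /negPf->]; rewrite !mul0r.
Qed.

Lemma sqr_hh_s : hh_s i A ^+ 2 = \sum_(j < n | (i < j)%N) A j i * A j i.
Proof.
rewrite sqr_sqrtr; last by apply: sumr_ge0 => j _; apply: sqr_ge0.
by apply: eq_bigr.
Qed.

Lemma hh_dot_col : \sum_j u j 0 * A j i = hh_denom i A.
Proof. by rewrite hh_sumE -sqr_hh_s /hh_denom; ring. Qed.

Lemma hh_dot_self : \sum_j u j 0 * u j 0 = 2 * hh_denom i A.
Proof.
have tail_dot : \sum_(j < n | (i < j)%N) A j i * u j 0 = hh_denom i A.
  rewrite -hh_dot_col big_mkcond; apply: eq_bigr => j _.
  by rewrite mulrC [u j 0]mxE; case: ltnP => _ //; rewrite mul0r.
rewrite hh_sumE tail_dot mxE ordS_val // leqNgt ltnSn /= eqxx mul1r /hh_denom.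
by ring.
Qed.

(** Squaring removes the root in [beta] because [2 (s^2 + r s)], being the
    squared length of [u], is nonnegative. *)
Lemma sqr_hh_beta : 2 * hh_beta i A ^+ 2 * hh_denom i A = 1.
Proof.
rewrite exprVn sqr_sqrtr -?hh_dot_self; last first.
  by apply: sumr_ge0 => j _; rewrite -expr2 sqr_ge0.
by rewrite hh_dot_self; field.
Qed.

Lemma householder_mxE x : householder_mx i A *m x =
  x - (2 * hh_beta i A ^+ 2 * \sum_j u j 0 * x j 0) *: u.
Proof.
rewrite /householder_mx hh_wE mulmxBl mul1mx; congr (_ - _).
rewrite linearZ -scalemxAr -(scalemxAl _ u) !scalerA.
by rewrite -scalemxAl mul_outer scalerA expr2 mulrA.
Qed.

(** With [beta^2 |u|^2 = 1] the matrix is a genuine reflection, hence symmetric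
    and its own inverse.  It subtracts [2 beta^2 <u, r> u = u] from the column
    [r], and [u] agrees with [r] below the index [i+1]. *)
Lemma householder_mxP :
  [/\ householder_mx i A \in unitmx,
      (invmx (householder_mx i A))^T = householder_mx i A,
      fixes_top i (householder_mx i A)
    & vanish_below i.+1 (invmx (householder_mx i A) *m col i A)].
Proof.
set Q := householder_mx i A.
have [Qu QV] : Q \in unitmx /\ invmx Q = Q.
  apply: unit_of_vec_inverse => x; rewrite /Q !householder_mxE.
  set c := \sum_j u j 0 * x j 0; set b := 2 * _.
  have -> : \sum_j u j 0 * (x - (b * c) *: u) j 0 =
      c - b * c * (2 * hh_denom i A).
    rewrite -hh_dot_self mulr_sumr -sumrB; apply: eq_bigr => j _.
    by rewrite !mxE; ring.
  have -> : b * (c - b * c * (2 * hh_denom i A)) = - (b * c).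
    have -> : b * (c - b * c * (2 * hh_denom i A)) =
      b * c - 2 * (b * hh_denom i A) * (b * c) by ring.
    by rewrite sqr_hh_beta; ring.
  by rewrite scaleNr opprK subrK.
split; rewrite ?QV //.
- by rewrite /Q /householder_mx linearB linearZ /= trmx1 trmx_mul trmxK.
- move=> x x0; rewrite householder_mxE big1 ?mulr0 ?scale0r ?subr0 // => j _.
  have [lt_ij|le_ji] := ltnP i j; first by rewrite x0 ?mulr0.
  by rewrite mxE le_ji mul0r.
move=> j lt_ij; rewrite householder_mxE.
have -> : \sum_k u k 0 * col i A k 0 = hh_denom i A.
  by rewrite -hh_dot_col; apply: eq_bigr => k _; rewrite [col i A k 0]mxE.
rewrite sqr_hh_beta scale1r !mxE leqNgt (ltnW lt_ij) /=.
by rewrite gtn_ordSF // mul0r addr0 subrr.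
Qed.

End Householder.

(** * One step of the reduction *)

Lemma antisym_entry (R : zmodType) n (C : 'M[R]_n) j k :
  C^T = - C -> C j k = - C k j.
Proof. by move=> /matrixP/(_ k j); rewrite !mxE. Qed.

Lemma antisym_diag (R : numDomainType) n (C : 'M[R]_n) j :
  C^T = - C -> C j j = 0.
Proof.
move=> /(antisym_entry j j)/eqP.
by rewrite -addr_eq0 -mulr2n mulrn_eq0 /= => /eqP.
Qed.

Section Step.

Variables (R : rcfType) (n : nat).
Implicit Types (A B C L Y : 'M[R]_n) (S U : 'M[R]_(n + n)) (i : 'I_n).

(** What the reduction needs from a step, abstracting from how the column of the
    upper left block is eliminated. *)
Definition elimination_step i S U := exists L : 'M[R]_n,
  [/\ L \in unitmx, fixes_top i L,
      vanish_below i.+1 (invmx L *m col i (ulsubmx S))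
    & U = shear_mx L (step_Y i S)].

Lemma constructionA_step i S U : (i.+1 < n)%N ->
  constructionA i S U -> elimination_step i S U.
Proof.
by move=> lt_in [L [/(elimination_mxP lt_in)[Lu Lf Lv] ->]]; exists L.
Qed.

Lemma constructionB_step i S U : (i.+1 < n)%N ->
  hh_denom i (ulsubmx S) != 0 -> constructionB i S U -> elimination_step i S U.
Proof.
move=> lt_in /(householder_mxP lt_in)[Qu QVT Qf Qv] ->.
by exists (householder_mx i (ulsubmx S)); rewrite /shear_mx QVT.
Qed.

Lemma step_Y_sym i S : (step_Y i S)^T = step_Y i S.
Proof. by rewrite linearZ /= trmx_mul trmxK. Qed.

Lemma step_YE i S x : step_Y i S *m x =
  ((step_sum i S)^-1 * \sum_(j < n | (i < j)%N) dlsubmx S j i * x j 0) *: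
    step_v i S.
Proof.
rewrite -scalemxAl mul_outer scalerA; congr (_ * _ *: _).
rewrite [RHS]big_mkcond; apply: eq_bigr => j _.
by rewrite mxE; case: ifP => _ //; rewrite mul0r.
Qed.

Lemma step_Y_kernel i S x : vanish_below i x -> step_Y i S *m x = 0.
Proof.
move=> x0; rewrite step_YE big1 ?mulr0 ?scale0r // => j lt_ij.
by rewrite x0 ?mulr0.
Qed.

(** The loop invariant: the block form of a skew-Hamiltonian matrix, together
    with what the first [m] steps achieve on the two left blocks. *)
Record reduced m S : Prop := Reduced {
  reduced_dr : drsubmx S = (ulsubmx S)^T;
  reduced_ur : (ursubmx S)^T = - ursubmx S;
  reduced_dl : (dlsubmx S)^T = - dlsubmx S;
  reduced_dl_col : forall k : 'I_n, (k < m)%N -> col k (dlsubmx S) = 0;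
  reduced_ul_col : forall k : 'I_n, (k < m)%N ->
    vanish_below k.+1 (col k (ulsubmx S)) }.

Lemma skew_hamiltonian_reduced S : skew_hamiltonian S -> reduced 0 S.
Proof.
rewrite /skew_hamiltonian -{1 2}(submxK S).
have -> : (sympJ R n)^T = block_mx 0 (- 1%:M) 1%:M 0.
  by rewrite /sympJ tr_block_mx linearN /= !trmx0 !trmx1.
rewrite /sympJ !mulmx_block !mul0mx !mulmx0 !mulmxN !mulNmx !mulmx1 !mul1mx.
rewrite !add0r !addr0 !opprK tr_block_mx => /eq_block_mx[e1 e2 e3 e4].
by split.
Qed.

(** The columns up to [i] are not affected by the right factor [L], so only the
    columns of the sheared blocks matter.  Before [i] they are unchanged by the
    shear; in column [i], the choice of [alpha] makes [Y A e_i] equal to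
    [C e_i]. *)
Lemma elimination_step_reduced i S U : (i.+1 < n)%N -> step_sum i S != 0 ->
  elimination_step i S U -> reduced i S -> reduced i.+1 (invmx U *m S *m U).
Proof.
move=> lt_in sum_neq0 [L [Lu Lfix Lhess ->]] [Sdr Sur Sdl dl0 ul0].
set Y := step_Y i S.
have YT : Y^T = Y by apply: step_Y_sym.
have Ycol (k : 'I_n) : (k <= i)%N -> col k Y = 0.
  move=> le_ki; rewrite colE step_Y_kernel //.
  exact/(vanish_belowW le_ki)/vanish_below_delta.
(* Antisymmetry of the lower left block kills its entries up to row [i]. *)
have vE : col i (dlsubmx S) = step_v i S.
  apply/colP => j; rewrite [RHS]mxE [LHS]mxE.
  case: ltngtP => // [lt_ji|/val_inj->]; last exact: antisym_diag.
  rewrite (antisym_entry _ _ Sdl); have /colP/(_ i) := dl0 j lt_ji.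
  by rewrite [LHS]mxE => ->; rewrite mxE oppr0.
rewrite -{1}(submxK S) shear_similarity // Sdr.
move: Sur Sdl dl0 ul0 vE Lhess.
set A := ulsubmx S; set B := ursubmx S; set C := dlsubmx S.
move=> Bt Ct C0 A0 vE Lhess.
split; rewrite ?block_mxKul ?block_mxKur ?block_mxKdl ?block_mxKdr.
- rewrite !trmx_mul mulmxA; congr (_ *m _ *m _).
  by rewrite linearD /= trmx_mul YT Bt mulmxN.
- by rewrite !trmx_mul trmxK Bt mulNmx mulmxN !mulmxA.
- rewrite !trmx_mul trmxK mulmxA; set X := _ + C.
  suff -> : X^T = - X by rewrite mulmxN mulNmx.
  have -> : X^T = - (Y *m B^T *m Y) + Y *m A - A^T *m Y + C^T.
    have trD (M N : 'M[R]_n) : (M + N)^T = M^T + N^T by rewrite linearD.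
    have trN (M : 'M[R]_n) : (- M)^T = - M^T by rewrite linearN.
    rewrite /X !trD !trN !trmx_mul trmxK.
    by rewrite YT mulmxA.
  rewrite Bt Ct mulmxN mulNmx opprK /X !opprD !opprK.
  by congr (_ - C); rewrite addrAC.
- move=> k le_ki; rewrite (col_mul_fixes_top _ le_ki) // colE -mulmxA.
  rewrite !mulmxDl !mulNmx -!mulmxA -!colE Ycol // !mulmx0 oppr0 !add0r.
  suff -> : - (Y *m col k A) + col k C = 0 by rewrite mulmx0.
  move: le_ki; rewrite ltnS leq_eqVlt.
  case/predU1P=> [/val_inj-> | lt_ki]; last first.
    by rewrite step_Y_kernel ?C0 ?addr0 ?oppr0 //; apply/vanish_belowW/A0.
  have sumE :
    \sum_(j < n | (i < j)%N) dlsubmx S j i * col i A j 0 = step_sum i S.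
    by apply: eq_bigr => j _; rewrite [col i A j 0]mxE.
  by rewrite vE step_YE sumE mulVf // scale1r addNr.
- move=> k le_ki; rewrite (col_mul_fixes_top _ le_ki) // colE -mulmxA.
  rewrite mulmxDl -mulmxA -!colE Ycol // mulmx0 addr0.
  move: le_ki; rewrite ltnS leq_eqVlt.
  case/predU1P=> [/val_inj-> // | lt_ki].
  rewrite (fixes_topV Lu Lfix); first exact: A0.
  by apply/vanish_belowW/A0.
Qed.

End Step.

(** * Composing the steps *)

Section PointedShear.

Variables (R : comUnitRingType) (n : nat).

(** The conditions that the first basis vector is fixed by [L] and killed by [Y]
    pass to products only together: the composition law evaluates [Y2] at
    [L1^-1 e_0].  They yield the zero first row and column. *)
Definition pointed_shear (U : 'M[R]_(n + n)) := exists L Y : 'M[R]_n,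
  [/\ L \in unitmx, fixes_top 0 L, Y^T = Y,
      forall x, vanish_below 0 x -> Y *m x = 0 & U = shear_mx L Y].

Lemma pointed_shear1 : pointed_shear 1%:M.
Proof.
exists 1%:M, 0; split; rewrite ?unitmx1 ?trmx0 //.
- exact: fixes_top1.
- by move=> x _; rewrite mul0mx.
by rewrite /shear_mx mul0mx invmx1 trmx1 -scalar_mx_block.
Qed.

Lemma pointed_shearM U1 U2 :
  pointed_shear U1 -> pointed_shear U2 -> pointed_shear (U1 *m U2).
Proof.
move=> [L1 [Y1 [L1u L1f Y1T Y1k ->]]] [L2 [Y2 [L2u L2f Y2T Y2k ->]]].
exists (L1 *m L2), (Y1 + (invmx L1)^T *m Y2 *m invmx L1); split.
- by rewrite unitmx_mul L1u.
- exact: fixes_topM.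
- by rewrite linearD /= !trmx_mul trmxK Y1T Y2T mulmxA.
- move=> x x0; rewrite mulmxDl Y1k // -!mulmxA (fixes_topV L1u L1f) //.
  by rewrite Y2k // mulmx0 addr0.
exact: shear_mx_mul.
Qed.

Lemma pointed_shear_unit U : pointed_shear U -> U \in unitmx.
Proof. by case=> [L [Y [Lu _ _ _ ->]]]; apply: shear_mx_unit. Qed.

(** Serves to see that a product of reflections equals its own inverse
    transpose: both are diagonal blocks of the accumulated transformation. *)
Lemma prod_diag_blocks_eq (U_ : nat -> 'M[R]_(n + n)) (m : nat) :
  (forall k, (k < m)%N -> exists Q X : 'M[R]_n, U_ k = block_mx Q 0 X Q) ->
  exists Q X : 'M[R]_n, \prod_(k < m) U_ k = block_mx Q 0 X Q.
Proof.
elim: m => [|m IHm] UE.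
  by exists 1%:M, 0; rewrite big_ord0 -scalar_mx_block.
have [k lt_km|Q1 [X1 E1]] := IHm; first exact/UE/ltnW.
have [Q2 [X2 E2]] := UE m (ltnSn m).
exists (Q1 *m Q2), (X1 *m Q2 + Q1 *m X2).
rewrite big_ord_recr /= -[_ * _]/(_ *m _) E1 E2 mulmx_block.
by rewrite !mul0mx !mulmx0 !addr0 add0r.
Qed.

End PointedShear.

Section Run.

Variables (R : rcfType) (n : nat).

Lemma elimination_step_pointed_shear (i : 'I_n) (S U : 'M[R]_(n + n)) :
  elimination_step i S U -> pointed_shear U.
Proof.
move=> [L [Lu Lfix _ ->]]; exists L, (step_Y i S); split=> //.
- exact: fixes_topW Lfix.
- exact: step_Y_sym.
- by move=> x /(vanish_belowW (leq0n i))/step_Y_kernel.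
Qed.

Lemma shear_riccati (S : 'M[R]_(n + n)) (L Y : 'M[R]_n) : L \in unitmx ->
  dlsubmx (invmx (shear_mx L Y) *m S *m shear_mx L Y) = 0 ->
  antisymmetric_riccati S Y.
Proof.
move=> Lu; rewrite -{1}(submxK S) shear_similarity // block_mxKdl => LXL0.
have LTu : L^T \in unitmx by rewrite unitmx_tr.
apply: (can_inj (mulKmx LTu)); apply: (can_inj (mulmxK Lu)).
by rewrite LXL0 mulmx0 mul0mx.
Qed.

Lemma sym_kernel_first_row_col (Y : 'M[R]_n) : Y^T = Y ->
  (forall x, vanish_below 0 x -> Y *m x = 0) -> first_row_col_zero Y.
Proof.
move=> YT Yk.
have Y0 (j k : 'I_n) : k == 0 :> nat -> Y j k = 0.
  move=> /eqP k0; have := @vanish_below_delta R n k; rewrite k0 => /Yk.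
  by rewrite -colE => /colP/(_ j); rewrite !mxE.
by move=> j k /orP[j0 | k0]; [rewrite -YT mxE|]; apply: Y0.
Qed.

(** The last column of the lower left block has only its diagonal entry left,
    which is zero by antisymmetry; the last column of the upper left block is
    Hessenberg for lack of rows below it. *)
Lemma reduced_final (S : 'M[R]_(n + n)) : reduced n.-1 S ->
  dlsubmx S = 0 /\ upper_hessenberg (ulsubmx S).
Proof.
move=> [_ _ Sdl dl0 ul0].
have last_idx (k : 'I_n) : (n.-1 <= k)%N -> k = n.-1 :> nat.
  move=> le_nk; apply/eqP; rewrite eqn_leq le_nk andbT -ltnS.
  by rewrite (ltn_predK (ltn_ord k)).
have last_max (j k : 'I_n) : (n.-1 <= k)%N -> (j <= k)%N.
  by move=> /last_idx->; rewrite -ltnS (ltn_predK (ltn_ord j)).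
have entry0 (j k : 'I_n) : (k < n.-1)%N -> dlsubmx S j k = 0.
  by move=> /dl0/colP/(_ j); rewrite !mxE.
split.
  apply/matrixP => j k; rewrite [RHS]mxE.
  have [/entry0 // | le_nk] := ltnP k n.-1.
  have [lt_jn | le_nj] := ltnP j n.-1.
    by rewrite (antisym_entry _ _ Sdl) entry0 ?oppr0.
  have -> : j = k.
    by apply: ord_inj; rewrite (last_idx j le_nj) (last_idx k le_nk).
  exact: (antisym_diag k Sdl).
move=> k j lt_kj; have [lt_kn | le_nk] := ltnP k n.-1.
  by have := ul0 k lt_kn j lt_kj; rewrite mxE.
by have := last_max j k le_nk; rewrite leqNgt (ltnW lt_kj).
Qed.

Lemma elimination_run (S : 'M[R]_(n + n)) (S_ U_ : nat -> 'M[R]_(n + n))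
    (S_skewH : skew_hamiltonian S) (S_init : S_ 0%N = S)
    (S_step : forall i : 'I_n, (i.+1 < n)%N ->
       S_ i.+1 = invmx (U_ i) *m S_ i *m U_ i)
    (sum_neq0 : forall i : 'I_n, (i.+1 < n)%N -> step_sum i (S_ i) != 0)
    (elim : forall i : 'I_n, (i.+1 < n)%N -> elimination_step i (S_ i) (U_ i))
    (m : nat) : (m <= n.-1)%N ->
  let U := \prod_(i < m) U_ i in
  [/\ reduced m (S_ m), pointed_shear U & S_ m = invmx U *m S *m U].
Proof.
elim: m => [|m IHm] lt_mn /=.
  rewrite big_ord0 S_init invmx1 mul1mx mulmx1; split=> //.
    exact: skew_hamiltonian_reduced.
  exact: pointed_shear1.
have lt_m1 : (m.+1 < n)%N by rewrite -ltn_predRL.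
have [Sred Ush Sm] := IHm (ltnW lt_mn).
pose i := Ordinal (ltnW lt_m1); have step_i := elim i lt_m1.
have Ui_sh := elimination_step_pointed_shear step_i.
rewrite big_ord_recr /= -[_ * _]/(_ *m _) (S_step i lt_m1); split.
- exact: elimination_step_reduced (sum_neq0 i lt_m1) step_i Sred.
- exact: pointed_shearM.
rewrite Sm invmx_mul ?(pointed_shear_unit Ush) ?(pointed_shear_unit Ui_sh) //.
by rewrite !mulmxA.
Qed.

End Run.

Theorem corollary2p4 (R : rcfType) (n : nat) (S : 'M[R]_(n + n))
    (S_ U_ : nat -> 'M[R]_(n + n))
    (S_skewH : skew_hamiltonian S)
    (S_init : S_ 0%N = S)
    (S_step : forall i : 'I_n, (i.+1 < n)%N ->
       S_ i.+1 = invmx (U_ i) *m S_ i *m U_ i)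
    (sum_neq0 : forall i : 'I_n, (i.+1 < n)%N -> step_sum i (S_ i) != 0) :
  let S' := S_ n.-1 in
  let U := \prod_(i < n.-1) U_ i in
  ((forall i : 'I_n, (i.+1 < n)%N -> constructionA i (S_ i) (U_ i)) ->
    dlsubmx S' = 0 /\ upper_hessenberg (ulsubmx S') /\
    exists L Y : 'M[R]_n,
      [/\ L \in unitmx,
          U = block_mx L 0 (Y *m L) (invmx L)^T,
          Y^T = Y,
          antisymmetric_riccati S Y
        & first_row_col_zero Y])
  /\
  ((forall i : 'I_n, (i.+1 < n)%N ->
      constructionB i (S_ i) (U_ i) /\ hh_denom i (ulsubmx (S_ i)) != 0) ->
    dlsubmx S' = 0 /\ upper_hessenberg (ulsubmx S') /\
    exists Q Y : 'M[R]_n,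
      [/\ Q \in unitmx,
          U = block_mx Q 0 (Y *m Q) Q,
          Y^T = Y,
          antisymmetric_riccati S Y
        & first_row_col_zero Y]).
Proof.
move=> S' U.
have conclude :
  (forall i : 'I_n, (i.+1 < n)%N -> elimination_step i (S_ i) (U_ i)) ->
  [/\ dlsubmx S' = 0, upper_hessenberg (ulsubmx S') & exists L Y : 'M[R]_n,
      [/\ L \in unitmx, U = shear_mx L Y, Y^T = Y,
          antisymmetric_riccati S Y & first_row_col_zero Y]].
  move=> steps.
  have /= := elimination_run S_skewH S_init S_step sum_neq0 steps (leqnn n.-1).
  rewrite -/S' -/U => -[/reduced_final[dl0 hess] [L [Y [Lu _ YT Yk UE]]] SE].
  split=> //; exists L, Y; split=> //; last exact: sym_kernel_first_row_col.
  by apply: (shear_riccati Lu); rewrite -UE -SE.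
split=> [stepsA | stepsB].
  by have [i lt_in|] := conclude; first exact/constructionA_step/stepsA.
have [i lt_in|dl0 hess [L [Y [Lu UE YT Yric Y0]]]] := conclude.
  by have [UB d_neq0] := stepsB i lt_in; apply: constructionB_step.
do 2!split=> //; exists L, Y; split=> //; rewrite UE.
(* The lower right block [L^-T] of [U] equals its upper left block [L]. *)
have [k lt_kn|Q [X]] := @prod_diag_blocks_eq R n U_ n.-1.
  have lt_k1 : (k.+1 < n)%N by rewrite -ltn_predRL.
  have [-> _] := stepsB (Ordinal (ltnW lt_k1)) lt_k1.
  by do 2!eexists.
rewrite -/U UE => /eq_block_mx[-> _ _ LVT].
by congr block_mx.
Qed.
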